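(* Let $R$ be a unique factorization domain and $I$ an ideal of $R$ with $|R/I|=4$. If $R/I\cong \mathbb{Z}[x]/(2,x^2+x)$ (as rings) and each of the two nonzero non-unit residue classes of $R/I$ (the classes corresponding to $x$ and $x+1$ under the isomorphism) contains at least one prime element of $R$, then $\rho_I(R)=\infty$. Otherwise, $\rho_I(R)=1$.
   Context: Let $R$ be a commutative domain with nonzero identity and $I$ an ideal of $R$. A $\tau_I$-factorization of $a\in R$ of length $k\geq 1$ is an expression $a=\lambda b_1\cdots b_k$ where $\lambda\in R$ is a unit, each $b_i\in R$ is a nonzero nonunit, and $b_i\equiv b_j \pmod I$ for all $i,j$ (there is no congruence condition on $\lambda$). A nonzero nonunit $a$ is a $\tau_I$-atom if all its $\tau_I$-factorizations have length one. An element $a$ is $\tau_I$-atomic if it has a $\tau_I$-factorization $a=\lambda b_1\cdots b_k$ in which every $b_i$ is a $\tau_I$-atom (a $\tau_I$-factorization into atoms). For a $\tau_I$-atomic element $m$, $$\rho_I(m)=\sup\{k/l : m \text{ has a } \tau_I\text{-factorization into atoms of length } k \text{ and one of length } l\},$$ and $\rho_I(R)=\sup\{\rho_I(m): m\in R,\ m \text{ is } \tau_I\text{-atomic}\}\in[1,\infty]$, with the convention that the supremum is $1$ if $R$ has no $\tau_I$-atomic elements (i.e. if $R$ is a field). It is not assumed that every nonzero nonunit of $R$ is $\tau_I$-atomic. *)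

(* Defs.v *)
From HB Require Import structures.
From mathcomp Require Import all_boot all_order all_algebra.
From mathcomp Require Import boolp classical_sets cardinality reals constructive_ereal ereal.

Set Implicit Arguments.
Unset Strict Implicit.
Unset Printing Implicit Defensive.

Import GRing.Theory.

Local Open Scope ring_scope.

Section Divisibility.
Variable R : idomainType.
Implicit Types (a b p : R) (s t : seq R).

Definition nonzero_nonunit a : Prop := a != 0 /\ a \isn't a GRing.unit.

Definition divides a b : Prop := exists c, b = a * c.

Definition associated a b : Prop := exists2 u, u \is a GRing.unit & b = u * a.

Definition irreducible_elt a : Prop :=
  nonzero_nonunit a /\
  forall b c, a = b * c -> b \is a GRing.unit \/ c \is a GRing.unit.

Definition prime_elt p : Prop :=
  nonzero_nonunit p /\
  forall a b, divides p (a * b) -> divides p a \/ divides p b.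

(* Existence of factorizations into irreducibles, and their uniqueness up to
   order and associates. Fields satisfy this. *)
Definition is_UFD : Prop :=
  (forall a, nonzero_nonunit a ->
     exists2 s, {in s, forall x, irreducible_elt x} & a = \prod_(x <- s) x) /\
  (forall s t,
     {in s, forall x, irreducible_elt x} ->
     {in t, forall x, irreducible_elt x} ->
     \prod_(x <- s) x = \prod_(x <- t) x ->
     exists t', [/\ perm_eq t t', size s = size t' &
       forall i, (i < size s)%N -> associated s`_i t'`_i]).

End Divisibility.

Section TauFactorization.
Variables (R : idomainType) (I : {pred R}).
Implicit Types (a m lambda : R) (bs : seq R).

Definition tau_factorization a lambda bs : Prop :=
  [/\ lambda \is a GRing.unit,
      (0 < size bs)%N,
      {in bs, forall b, nonzero_nonunit b},
      {in bs &, forall b b', b - b' \in I} &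
      a = lambda * \prod_(b <- bs) b].

Definition tau_atom a : Prop :=
  nonzero_nonunit a /\
  forall lambda bs, tau_factorization a lambda bs -> size bs = 1%N.

Definition has_atomic_factorization a (k : nat) : Prop :=
  exists lambda bs,
    [/\ tau_factorization a lambda bs,
        {in bs, forall b, tau_atom b} &
        size bs = k].

Definition tau_atomic a : Prop := exists k, has_atomic_factorization a k.

(* The elasticities are extended reals over an arbitrary model K of the real
   numbers. Lengths are positive, so no division by zero occurs. *)
Variable K : realType.

Definition elasticity_elt m : \bar K :=
  ereal_sup [set r | exists k l : nat,
    [/\ has_atomic_factorization m k,
        has_atomic_factorization m l &
        r = (k%:R / l%:R)%:E]]%classic.

Definition elasticity : \bar K :=
  if `[< exists m, tau_atomic m >]
  then ereal_sup [set elasticity_elt m | m in [set m | tau_atomic m]]%classic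
  else 1%E.

End TauFactorization.

(* The ideal (2, x^2 + x) of Z[x]. *)
Definition ideal_2_X2X : {pred {poly int}} :=
  fun p => `[< exists u v : {poly int}, p = u * 2%:R + v * ('X^2 + 'X) >].

Lemma ideal_2_X2X_idealr_closed : idealr_closed ideal_2_X2X.
Proof.
split.
- by apply/asboolP; exists 0, 0; rewrite !mul0r addr0.
- apply/negP => /asboolP [u [v /(congr1 (horner^~ 0))]].
  rewrite !hornerE => /(congr1 (fun z : int => (z %% 2)%Z)).
  by rewrite -[1 + 1]/(2%:Z) modzMl.
- move=> a p q /asboolP [u [v ->]] /asboolP [u' [v' ->]]; apply/asboolP.
  exists (a * u + u'), (a * v + v').
  by rewrite !mulrDl mulrDr !mulrA addrACA.
Qed.

HB.instance Definition _ :=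
  isIdealr.Build {poly int} ideal_2_X2X ideal_2_X2X_idealr_closed.

(* Main.v *)
Require Import Defs.
From HB Require Import structures.
From mathcomp Require Import all_boot all_order all_algebra.
From mathcomp Require Import boolp classical_sets cardinality reals constructive_ereal ereal.

Set Implicit Arguments.
Unset Strict Implicit.
Unset Printing Implicit Defensive.

Import Order.TTheory GRing.Theory Num.Theory.
Local Open Scope ring_scope.

(** Write Q = R/I. Everything is decided by the multiset of residue classes of
    the irreducible factors of an element, because the class of a product is
    the product of the classes. A four-element ring is either F_2 x F_2, which
    here means that it has an idempotent e outside {0, 1}, or local, with
    square-zero maximal ideal having at most one nonzero element
    ([four_elements_cases]).

    If Q is F_2 x F_2, then e and 1 + e both contain primes p and q: a product
    of classes equal to e can only involve the classes 1 and e, and not only 1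
    ([klein_class_prime]). Then p^i q^j lies in class 0 for i, j > 0, and so do
    all the factors in any of its tau-factorizations, since every class is
    idempotent; hence each factor is divisible both by a prime in class e and
    by a prime in class 1 + e, and p^i q^j is an atom as soon as i = 1 or j = 1
    ([primes_prod_atom]). So (p q)^n = (p q^(n-1)) (p^(n-1) q) has atomic
    factorizations of lengths n and 2, and the elasticity is infinite.

    If Q is local, all atomic factorizations of m have the same length. Since
    the leading unit of a tau-factorization is arbitrary, classes only matter
    up to the image of the units of R ([tau_atom_sim]); write ~ for this
    relation. The invertible classes modulo ~ form a group of order at most 3.
    An atom can never be split into two or three nonunits of equivalent
    classes, which leaves the following atoms:
    - in an invertible class x with x not ~ 1: exactly one irreducible factor
      has a class not ~ 1, and that class is ~ x ([class_inv_atom]);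
    - in class ~ 1: an irreducible element, or a product of two irreducibles in
      inequivalent classes not ~ 1 ([class1_atom]);
    - in class 0: exactly one irreducible factor in class 0 ([class0_atom]);
    - in a nonzero noninvertible class: no irreducible factor in class 0, and
      exactly one in a noninvertible class ([class0_mult],
      [mult_class_ninv]).
    In each case the length of a factorization into such atoms is a function of
    the numbers of irreducible factors of m in the various classes, and two
    cases that prescribe different functions exclude each other
    ([local_length_unique]). *)

(** * The ring F_2 x F_2 and its presentation Z[x]/(2, x^2 + x) *)

(** The ring F_2 x F_2, presented by one of its two nontrivial idempotents. *)
Definition klein (A : comNzRingType) (e : A) : Prop :=
  [/\ 1 + 1 = 0 :> A, e * e = e, e != 0, e != 1 &
      forall x : A, [\/ x = 0, x = 1, x = e | x = 1 + e]].

Section Klein.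
Variables (A : comNzRingType) (e : A).
Hypothesis Ke : klein e.

Lemma klein_addxx (x : A) : x + x = 0.
Proof. by case: Ke => h _ _ _ _; rewrite -[x]mulr1 -mulrDr h mulr0. Qed.

Lemma klein_idem (x : A) : x * x = x.
Proof.
case: Ke => _ ee _ _ /(_ x) [] ->; rewrite ?mulr0 ?mulr1 //.
by rewrite mulrDl mul1r mulrDr mulr1 ee klein_addxx addr0.
Qed.

Lemma klein_mul_compl : e * (1 + e) = 0.
Proof. by rewrite mulrDr mulr1 klein_idem klein_addxx. Qed.

Lemma klein_compl_neq0 : 1 + e != 0.
Proof.
case: Ke => _ _ _ e1 _; apply: contra e1 => /eqP h.
by rewrite -[e]add0r -(klein_addxx 1) -addrA h addr0.
Qed.

(** Exchanges the two factors of F_2 x F_2, so that what is proved about e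
    also holds for 1 + e. *)
Lemma klein_sym : klein (1 + e).
Proof.
have K : 1 + (1 + e) = e by rewrite addrA klein_addxx add0r.
case: Ke => h _ e0 e1 c; split=> //; rewrite ?klein_idem ?klein_compl_neq0 //.
  by apply: contra e0 => /eqP h1; rewrite -K h1 h.
by move=> x; rewrite K; case: (c x) => ->; [constructor 1|constructor 2|constructor 4|constructor 3].
Qed.

End Klein.

Section KleinIso.
Variables (A B : comNzRingType) (e : A) (f : B).
Hypotheses (Ke : klein e) (Kf : klein f).

Definition klein_map (x : A) : B :=
  if x == 0 then 0 else if x == 1 then 1 else if x == e then f else 1 + f.

Lemma klein_map0 : klein_map 0 = 0. Proof. by rewrite /klein_map eqxx. Qed.

Lemma klein_map1 : klein_map 1 = 1.
Proof. by rewrite /klein_map oner_eq0 eqxx. Qed.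

Lemma klein_mape : klein_map e = f.
Proof. by case: Ke => _ _ /negPf e0 /negPf e1 _; rewrite /klein_map e0 e1 eqxx. Qed.

Lemma klein_map_compl : klein_map (1 + e) = 1 + f.
Proof.
case: Ke => _ _ e0 e1 _; rewrite /klein_map (negPf (klein_compl_neq0 Ke)).
rewrite -subr_eq0 addrAC subrr add0r (negPf e0).
by rewrite -subr_eq0 addrK oner_eq0.
Qed.

Definition klein_mapE := (klein_map0, klein_map1, klein_mape, klein_map_compl).

Lemma klein_mapD : {morph klein_map : x y / x + y}.
Proof.
have KA : 1 + (1 + e) = e by rewrite addrA (klein_addxx Ke) add0r.
have KB : 1 + (1 + f) = f by rewrite addrA (klein_addxx Kf) add0r.
have LA : e + (1 + e) = 1 by rewrite addrCA (klein_addxx Ke) addr0.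
have LB : f + (1 + f) = 1 by rewrite addrCA (klein_addxx Kf) addr0.
case: (Ke) (Kf) => _ _ _ _ c [_ _ _ _ _] x y.
have RA : ((1 + e) + 1 = e) * ((1 + e) + e = 1) * (e + 1 = 1 + e).
  by rewrite ![(1 + e) + _]addrC KA LA addrC.
have RB : ((1 + f) + 1 = f) * ((1 + f) + f = 1) * (f + 1 = 1 + f).
  by rewrite ![(1 + f) + _]addrC KB LB addrC.
by case: (c x) => ->; case: (c y) => ->;
  rewrite ?(add0r, addr0, klein_addxx Ke) ?(KA, LA, RA) ?klein_mapE
    ?(add0r, addr0, klein_addxx Kf) ?(KB, LB, RB).
Qed.

Lemma klein_mapM : {morph klein_map : x y / x * y}.
Proof.
case: (Ke) => _ _ _ _ c x y.
by case: (c x) => ->; case: (c y) => ->;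
  rewrite ?(mul0r, mulr0, mul1r, mulr1) ?(klein_idem Ke) ?(mulrC (1 + e) e)
    ?(klein_mul_compl Ke) ?klein_mapE ?(mul0r, mulr0, mul1r, mulr1) ?(klein_idem Kf)
    ?(mulrC (1 + f) f) ?(klein_mul_compl Kf).
Qed.

Lemma klein_mapB : {morph klein_map : x y / x - y}.
Proof.
move=> x y; have oA (z : A) : - z = z by apply/eqP; rewrite eq_sym -addr_eq0 (klein_addxx Ke).
have oB (z : B) : - z = z by apply/eqP; rewrite eq_sym -addr_eq0 (klein_addxx Kf).
by rewrite oA klein_mapD oB.
Qed.

End KleinIso.

Lemma klein_iso (A B : comNzRingType) (e : A) (f : B) : klein e -> klein f ->
  exists g : {rmorphism A -> B}, bijective g.
Proof.
move=> Ke Kf.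
have K (C D : comNzRingType) (c : C) (d : D) (Kc : klein c) (Kd : klein d) :
    cancel (klein_map c d) (klein_map d c).
  by case: (Kc) => _ _ _ _ h x; case: (h x) => ->; rewrite !klein_mapE.
have [g gE] : exists g : {rmorphism A -> B}, g =1 klein_map e f.
  pose gA := GRing.isZmodMorphism.Build A B _ (klein_mapB Ke Kf).
  pose gM := GRing.isMonoidMorphism.Build A B _
    (klein_map1 e f, klein_mapM Ke Kf).
  by exists (HB.pack (klein_map e f) gA gM : {rmorphism A -> B}).
exists g; exists (klein_map f e) => x; rewrite gE; exact: K.
Qed.

Section KleinPoly.
Local Notation T := {ideal_quot ideal_2_X2X}.
Local Open Scope quotient_scope.
Local Notation pi := (\pi_T : {rmorphism {poly int} -> T}).

Lemma poly_quot_eq0 p : (pi p == 0) = (p \in ideal_2_X2X).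
Proof. by rewrite -[p in RHS]subr0 Quotient.idealrBE -(rmorph0 pi). Qed.

(** Reduction by X^2 = X and 2 = 0 leaves only 0, 1, X and 1 + X. Polynomials
    in the ideal take even values on the integers, since x^2 + x is even; the
    values of X at 1 and of X - 1 at 0 show that X is neither 0 nor 1. *)
Lemma klein_poly : klein (pi 'X).
Proof.
have two : 1 + 1 = 0 :> T.
  apply/eqP; rewrite -(rmorph1 pi) -rmorphD poly_quot_eq0; apply/asboolP.
  by exists 1, 0; rewrite mul1r mul0r addr0.
have addxx (x : T) : x + x = 0 by rewrite -[x]mulr1 -mulrDr two mulr0.
have XX : pi 'X * pi 'X = pi 'X.
  have /eqP : pi ('X * 'X + 'X) == 0.
    rewrite poly_quot_eq0; apply/asboolP; exists 0, 1.
    by rewrite mul0r mul1r add0r expr2.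
  rewrite rmorphD rmorphM => h.
  by rewrite -[LHS]addr0 -(addxx (pi 'X)) addrA h add0r.
have even_val p (x : int) : p \in ideal_2_X2X ->
    (2 %| x ^+ 2 + x)%Z -> (2 %| p.[x])%Z.
  move=> /asboolP[u [v ->]] h; rewrite !hornerE.
  have -> : 1 + 1 = 2 :> int by [].
  by rewrite rpredD // ?dvdz_mull.
split=> //.
- by rewrite poly_quot_eq0; apply/negP => /(even_val _ 1)/(_ isT); rewrite hornerX.
- rewrite -subr_eq0 -(rmorph1 pi) -rmorphB poly_quot_eq0.
  by apply/negP => /(even_val _ 0)/(_ isT); rewrite !hornerE.
- suff KP p : [\/ pi p = 0, pi p = 1, pi p = pi 'X | pi p = 1 + pi 'X].
    by move=> x; rewrite -[x]reprK; apply: KP.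
  elim/poly_ind: p => [|p c IH]; first by constructor 1; rewrite rmorph0.
  have hc : [\/ pi c%:P = 0 | pi c%:P = 1].
    rewrite (divz_eq c 2) rmorphD rmorphM /= rmorphD rmorphM /=.
    have -> : pi 2%:P = 0 by rewrite -two -(rmorph1 pi) -rmorphD; congr (pi _); rewrite -polyC1 -polyCD.
    rewrite mulr0 add0r.
    have : (0 <= c %% 2 < 2)%Z by rewrite modz_ge0 // ltz_pmod.
    case: (c %% 2)%Z => [[|[|n]]|n] //= _; [left|right]; first by rewrite rmorph0.
    by rewrite -(rmorph1 pi) polyC1.
  have hX : [\/ pi (p * 'X) = 0 | pi (p * 'X) = pi 'X].
    rewrite rmorphM; case: IH => ->; rewrite ?mul0r ?mul1r ?XX;
      [by left|by right|by right|left].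
    by rewrite mulrDl mul1r XX addxx.
  rewrite rmorphD; case: hX => ->; case: hc => ->; rewrite ?add0r ?addr0.
  - by constructor 1.
  - by constructor 2.
  - by constructor 3.
  - by rewrite addrC; constructor 4.
Qed.

End KleinPoly.

(** * Counting irreducible factors *)

Section UniqueFactorization.
Variables (R : idomainType) (R_UFD : is_UFD R).
Implicit Types (a b c p u : R) (s t : seq R) (P : pred R).

Definition factors_as a s : Prop :=
  {in s, forall x, irreducible_elt x} /\
  exists2 u, u \is a GRing.unit & a = u * \prod_(x <- s) x.

Definition factors a : seq R := xget [::] [set s | factors_as a s]%classic.

(** Number of irreducible factors of [a] in [P], with multiplicity. In a
    UFD, and for [P] closed under associates, the chosen factorization does not
    matter. *)
Definition mult P a : nat := count P (factors a).

Definition assoc_closed P : Prop :=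
  forall u a, u \is a GRing.unit -> P (u * a) = P a.

Lemma irreducible_neq0 p : irreducible_elt p -> p != 0.
Proof. by case=> -[]. Qed.

Lemma irreducible_assoc u p :
  u \is a GRing.unit -> irreducible_elt p -> irreducible_elt (u * p).
Proof.
move=> uU [[p0 pN] pI]; split.
  split; first by rewrite mulf_neq0 //; apply: contraTneq uU => ->; rewrite unitr0.
  by rewrite unitrM uU.
move=> b c e; have /pI [] : p = (u^-1 * b) * c.
- by rewrite -mulrA -e mulKr.
- by rewrite unitrM unitrV uU /=; left.
- by right.
Qed.

Lemma nonzero_nonunitM a b :
  nonzero_nonunit a -> b != 0 -> nonzero_nonunit (a * b).
Proof.
by move=> [a0 aN] b0; split; [rewrite mulf_neq0 | rewrite unitrM (negPf aN)].
Qed.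

Lemma factors_asP a : a != 0 -> factors_as a (factors a).
Proof.
move=> a0; rewrite /factors; apply: xgetPex.
have [aU|aN] := boolP (a \is a GRing.unit).
  by exists [::]; split=> //; exists a => //; rewrite big_nil mulr1.
have [s sI ->] := R_UFD.1 a (conj a0 aN).
by exists s; split=> //; exists 1; rewrite ?unitr1 ?mul1r.
Qed.

Lemma prod_irreducible_unit s :
  {in s, forall x, irreducible_elt x} ->
  \prod_(x <- s) x \is a GRing.unit -> s = [::].
Proof.
case: s => [//|x s] sI; rewrite big_cons unitrM => /andP[xU _].
by have [[_ /negP]] := sI x (mem_head _ _).
Qed.

Lemma count_assoc P s t : assoc_closed P -> size s = size t ->
  (forall i, (i < size s)%N -> associated s`_i t`_i) -> count P s = count P t.
Proof.
move=> Pc; elim: s t => [|x s IH] [|y t] //= [sz] as_.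
have [u uU /= ->] := as_ 0%N isT; rewrite Pc //; congr addn.
by apply: IH => // i ilt; apply: (as_ i.+1).
Qed.

(** Uniqueness of factorizations, with the unit absorbed in the first
    irreducible factor. *)
Lemma count_factors_as P a s t : assoc_closed P ->
  factors_as a s -> factors_as a t -> count P s = count P t.
Proof.
move=> Pc [sI [u uU ->]] [tI [v vU e]].
have {e} : (v^-1 * u) * \prod_(x <- s) x = \prod_(x <- t) x.
  by rewrite -mulrA e mulKr.
have : v^-1 * u \is a GRing.unit by rewrite unitrM unitrV vU.
move: (v^-1 * u) => w wU {u v uU vU}.
case: s sI => [|x s] sI.
  rewrite big_nil mulr1 => e.
  by rewrite (@prod_irreducible_unit t) // -e.
rewrite big_cons mulrA -(big_cons _ _ (w * x) s xpredT id) => e.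
have sI' : {in (w * x) :: s, forall y, irreducible_elt y}.
  move=> y; rewrite inE => /predU1P[->|ys]; last by apply: sI; rewrite inE ys orbT.
  by apply: irreducible_assoc => //; apply: sI; rewrite mem_head.
have [t' [ptt' sz as_]] := R_UFD.2 _ _ sI' tI e.
rewrite (permP ptt') -(count_assoc Pc sz as_) /= Pc //.
Qed.

Lemma multE P a s : assoc_closed P -> factors_as a s -> mult P a = count P s.
Proof.
move=> Pc as_; apply: (@count_factors_as _ a) => //.
by rewrite /factors; apply: xgetPex; exists s.
Qed.

Lemma multM P a b : assoc_closed P -> a != 0 -> b != 0 ->
  mult P (a * b) = (mult P a + mult P b)%N.
Proof.
move=> Pc /factors_asP[aI [u uU ea]] /factors_asP[bI [v vU eb]].
rewrite /mult -count_cat; apply: multE => //; split.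
  by move=> x; rewrite mem_cat => /orP[/aI|/bI].
by exists (u * v); rewrite ?unitrM ?uU // big_cat /= mulrACA -ea -eb.
Qed.

Lemma mult_unit P u : assoc_closed P -> u \is a GRing.unit -> mult P u = 0%N.
Proof.
move=> Pc uU; rewrite (@multE _ _ [::]) //.
by split=> //; exists u; rewrite ?big_nil ?mulr1.
Qed.

Lemma mult_irreducible P p :
  assoc_closed P -> irreducible_elt p -> mult P p = P p.
Proof.
move=> Pc pI; rewrite (@multE _ _ [:: p]) ?addn0 //; first by rewrite /= addn0.
split; first by move=> x; rewrite inE => /eqP ->.
by exists 1; rewrite ?unitr1 ?big_seq1 ?mul1r.
Qed.

Lemma mult_prod P s : assoc_closed P -> {in s, forall b, b != 0} ->
  mult P (\prod_(b <- s) b) = (\sum_(b <- s) mult P b)%N.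
Proof.
move=> Pc; elim: s => [|b s IH] s0; first by rewrite !big_nil mult_unit ?unitr1.
have s0' : {in s, forall b, b != 0}.
  by move=> c cs; apply: s0; rewrite inE cs orbT.
rewrite !big_cons multM ?IH //; first exact/s0/mem_head.
by rewrite prodf_seq_neq0; apply/allP => c /s0'.
Qed.

(** Induction on the number of irreducible factors. *)
Lemma factor_ind (K : R -> Prop) :
  (forall u, u \is a GRing.unit -> K u) ->
  (forall p c, irreducible_elt p -> c != 0 -> K c -> K (p * c)) ->
  forall a, a != 0 -> K a.
Proof.
move=> KU KM a /factors_asP[+ [u uU ->]]; move: (factors a) => s sI.
elim: s sI => [|p s IH] sI; first by rewrite big_nil mulr1; apply: KU.
have sI' : {in s, forall x, irreducible_elt x}.
  by move=> x xs; apply: sI; rewrite inE xs orbT.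
rewrite big_cons mulrCA; apply: KM; [exact/sI/mem_head | | exact: IH].
rewrite mulf_neq0 //; first by apply: contraTneq uU => ->; rewrite unitr0.
by rewrite prodf_seq_neq0; apply/allP => x /sI' /irreducible_neq0.
Qed.

Lemma mult_gt0P P a : assoc_closed P -> a != 0 -> (0 < mult P a)%N ->
  exists p c, [/\ a = p * c, irreducible_elt p, P p & c != 0].
Proof.
move=> Pc; elim/factor_ind => [u uU|p c pI c0 IH]; first by rewrite mult_unit.
rewrite multM ?(irreducible_neq0 pI) // mult_irreducible //.
have [Pp _|Pp] := boolP (P p); first by exists p, c.
rewrite add0n => /IH [q [d [-> qI Pq d0]]]; exists q, (p * d); split=> //.
  by rewrite mulrCA.
by rewrite mulf_neq0 ?(irreducible_neq0 pI).
Qed.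

Lemma nonzero_nonunit_factor a : nonzero_nonunit a ->
  exists p c, [/\ a = p * c, irreducible_elt p & c != 0].
Proof.
case=> a0; elim/factor_ind: a / a0 => [u -> //|p c pI c0 _ _].
by exists p, c.
Qed.

Lemma irreducible_nonzero_nonunit p : irreducible_elt p -> nonzero_nonunit p.
Proof. by case. Qed.

Definition associate_pred p : pred R := fun x => `[< associated p x >].

Lemma associate_pred_closed p : assoc_closed (associate_pred p).
Proof.
move=> u a uU; apply/asboolP/asboolP => -[v vU e].
  by exists (u^-1 * v); rewrite ?unitrM ?unitrV ?uU // -mulrA -e mulKr.
by exists (u * v); rewrite ?unitrM ?uU // e mulrA.
Qed.

(** Counting the irreducible factors associated to [p] on both sides of
    p c = a b shows that [a] or [b] has one. *)
Lemma irreducible_prime p : irreducible_elt p -> prime_elt p.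
Proof.
move=> pI; split; first exact: irreducible_nonzero_nonunit.
move=> a b [c e].
have [->|a0] := eqVneq a 0; first by left; exists 0; rewrite mulr0.
have [->|b0] := eqVneq b 0; first by right; exists 0; rewrite mulr0.
have pc := associate_pred_closed p.
have c0 : c != 0.
  by apply: contraTneq (mulf_neq0 a0 b0) => c0; rewrite e c0 mulr0 eqxx.
have pp : associate_pred p p by apply/asboolP; exists 1; rewrite ?unitr1 ?mul1r.
have dvd d : d != 0 -> (0 < mult (associate_pred p) d)%N -> divides p d.
  move=> d0 /(mult_gt0P pc d0)[q [d' [-> _ /asboolP[u uU ->] _]]].
  by exists (u * d'); rewrite mulrA (mulrC p).
have: (0 < mult (associate_pred p) (a * b))%N.
  by rewrite e multM ?(irreducible_neq0 pI) // mult_irreducible // pp.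
by rewrite multM // addn_gt0 => /orP[/dvd|/dvd] h; [left|right]; apply: h.
Qed.

End UniqueFactorization.

(** * Residue classes up to units *)

Section ResidueClasses.
Variables (R : idomainType) (Q : comNzRingType) (pi : {rmorphism R -> Q}).
Variable I : {pred R}.
Hypothesis pi_eq : forall a b, a - b \in I <-> pi a = pi b.
Implicit Types (a b c d p q u : R) (x y z w : Q) (bs : seq R).

Definition inv x : Prop := exists y, x * y = 1.

(** Congruence up to the units of [R], not up to those of [Q]: the units of
    [R] may reach only part of the invertible classes. *)
Definition sim x y : Prop := exists2 u, u \is a GRing.unit & x = pi u * y.

Definition classes (K : Q -> Prop) : pred R := fun a => `[< K (pi a) >].

Lemma sim_refl x : sim x x.
Proof. by exists 1; rewrite ?unitr1 // rmorph1 mul1r. Qed.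

Lemma sim_sym x y : sim x y -> sim y x.
Proof.
case=> u uU ->; exists u^-1; rewrite ?unitrV //.
by rewrite mulrA -rmorphM mulVr // rmorph1 mul1r.
Qed.

Lemma sim_trans y x z : sim x y -> sim y z -> sim x z.
Proof.
move=> [u uU ->] [v vU ->]; exists (u * v); first by rewrite unitrM uU.
by rewrite rmorphM mulrA.
Qed.

Lemma simM x y z w : sim x y -> sim z w -> sim (x * z) (y * w).
Proof.
move=> [u uU ->] [v vU ->]; exists (u * v); first by rewrite unitrM uU.
by rewrite rmorphM mulrACA.
Qed.

Lemma sim_unit u : u \is a GRing.unit -> sim (pi u) 1.
Proof. by move=> uU; exists u; rewrite ?mulr1. Qed.

Lemma inv1 : inv 1. Proof. by exists 1; rewrite mulr1. Qed.

Lemma inv0 : ~ inv 0.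
Proof. by case=> y /esym/eqP; rewrite mul0r oner_eq0. Qed.

Lemma invM x y : inv (x * y) <-> inv x /\ inv y.
Proof.
split=> [[z e]|[[z ez] [w ew]]]; last by exists (z * w); rewrite mulrACA ez ew mulr1.
by split; [exists (y * z); rewrite mulrA | exists (x * z); rewrite mulrCA mulrA].
Qed.

Lemma inv_pi u : u \is a GRing.unit -> inv (pi u).
Proof. by move=> uU; exists (pi u^-1); rewrite -rmorphM mulrV // rmorph1. Qed.

Lemma inv_sim x y : sim x y -> inv x -> inv y.
Proof. by case=> u _ -> /invM[]. Qed.

Lemma sim1_inv x : sim x 1 -> inv x.
Proof. by move=> /sim_sym s; apply: inv_sim s inv1. Qed.

Lemma sim_mul1 x y : sim y 1 -> sim (x * y) x.
Proof. by move=> s; rewrite -[X in sim _ X]mulr1; apply: simM => //; apply: sim_refl. Qed.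

Lemma classes_closed K :
  (forall x y, sim x y -> K x -> K y) -> assoc_closed (classes K).
Proof.
move=> Ks u a uU; apply/asboolP/asboolP; apply: Ks.
  by exists u => //; rewrite rmorphM.
by apply: sim_sym; exists u => //; rewrite rmorphM.
Qed.

Lemma nonunit_nsim1 d : d != 0 -> ~ sim (pi d) 1 -> nonzero_nonunit d.
Proof. by move=> d0 h; split=> //; apply/negP => /sim_unit. Qed.

Lemma nonunit_ninv d : d != 0 -> ~ inv (pi d) -> nonzero_nonunit d.
Proof. by move=> d0 h; split=> //; apply/negP => /inv_pi. Qed.

(** The unit in front of a factorization carries no congruence condition, so
    factors that agree only up to units of the ring can be rescaled until they
    are congruent. *)
Lemma tau_atom_sim a u bs : tau_atom I a -> u \is a GRing.unit ->
  (0 < size bs)%N -> {in bs, forall b, nonzero_nonunit b} ->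
  {in bs &, forall b c, sim (pi b) (pi c)} ->
  a = u * \prod_(b <- bs) b -> size bs = 1%N.
Proof.
move=> [_ aA] uU; case: bs => [//|b0 bs] _ bsN bsS ea.
have /choice[w wP] : forall b, exists v, b \in b0 :: bs ->
    v \is a GRing.unit /\ pi (v^-1 * b) = pi b0.
  move=> b; have [bI|_] := boolP (b \in b0 :: bs); last by exists 1.
  have [v vU e] := bsS _ _ bI (mem_head _ _); exists v => _; split=> //.
  by rewrite rmorphM e mulrA -rmorphM mulVr // rmorph1 mul1r.
have wU b : b \in b0 :: bs -> w b \is a GRing.unit by move=> /wP[].
rewrite -(size_map (fun b => (w b)^-1 * b)).
apply: (aA (u * \prod_(b <- b0 :: bs) w b)).
split=> //.
- rewrite unitrM uU big_seq /=; elim/big_ind: (\prod_(_ <- _ | _) _) => [|b c bU cU|b /wU //].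
    exact: unitr1.
  by rewrite unitrM bU.
- move=> _ /mapP[b bI ->]; have [b0_ bN] := bsN _ bI; split.
    rewrite mulf_neq0 // invr_eq0; apply: contraTneq (wU _ bI) => ->.
    by rewrite unitr0.
  by rewrite unitrM unitrV wU.
- move=> _ _ /mapP[b bI ->] /mapP[c cI ->]; apply/pi_eq.
  by rewrite (wP _ bI).2 (wP _ cI).2.
- rewrite ea -mulrA big_map -big_split /=; congr (u * _).
  rewrite big_seq [RHS]big_seq; apply: eq_bigr => b /wU wb.
  by rewrite mulVKr.
Qed.

Lemma tau_atom_split2 b c : nonzero_nonunit b -> nonzero_nonunit c ->
  sim (pi b) (pi c) -> ~ tau_atom I (b * c).
Proof.
move=> bN cN bc /(@tau_atom_sim _ 1 [:: b; c]) h.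
suff: size [:: b; c] = 1%N by [].
apply: h => //; first exact: unitr1.
- by move=> d; rewrite !inE => /orP[] /eqP ->.
- move=> d e; rewrite !inE => /orP[] /eqP -> /orP[] /eqP -> //;
    by [apply: sim_refl | apply: sim_sym].
- by rewrite big_cons big_seq1 mul1r.
Qed.

Lemma tau_atom_split3 b c d :
  nonzero_nonunit b -> nonzero_nonunit c -> nonzero_nonunit d ->
  sim (pi b) (pi c) -> sim (pi c) (pi d) -> ~ tau_atom I (b * (c * d)).
Proof.
move=> bN cN dN bc cd /(@tau_atom_sim _ 1 [:: b; c; d]) h.
suff: size [:: b; c; d] = 1%N by [].
have bd := sim_trans bc cd.
apply: h => //; first exact: unitr1.
- by move=> e; rewrite !inE => /or3P[] /eqP ->.
- move=> e f; rewrite !inE => /or3P[] /eqP -> /or3P[] /eqP -> //;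
    by [apply: sim_refl | apply: sim_sym].
- by rewrite !big_cons big_nil mulr1 mul1r.
Qed.

Hypothesis R_UFD : is_UFD R.
Definition class1 := classes (fun x => sim x 1).
Definition class_inv := classes (fun x => inv x /\ ~ sim x 1).
Definition class_inv_but z := classes (fun x => [/\ inv x, ~ sim x 1 & ~ sim x z]).
Definition class0 := classes (fun x => x = 0).
Definition class_ninv := classes (fun x => ~ inv x /\ x != 0).

Lemma class1_closed : assoc_closed class1.
Proof. by apply: classes_closed => x y /sim_sym xy; apply: sim_trans. Qed.

Lemma class_inv_closed : assoc_closed class_inv.
Proof.
apply: classes_closed => x y xy [xi x1]; split; first exact: inv_sim xi.
by move=> y1; apply: x1; apply: sim_trans y1.
Qed.

Lemma class_inv_but_closed z : assoc_closed (class_inv_but z).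
Proof.
apply: classes_closed => x y xy [xi x1 xz]; split; first exact: inv_sim xi.
- by move=> y1; apply: x1; apply: sim_trans y1.
- by move=> yz; apply: xz; apply: sim_trans yz.
Qed.

Lemma class0_closed : assoc_closed class0.
Proof.
by apply: classes_closed => x y /sim_sym[u _ ->] ->; rewrite mulr0.
Qed.

Lemma class_ninv_closed : assoc_closed class_ninv.
Proof.
apply: classes_closed => x y xy [xi x0]; split.
  by move=> yi; apply: xi; apply: inv_sim yi; apply: sim_sym.
by apply: contraNneq x0; case: xy => u _ -> ->; rewrite mulr0.
Qed.

#[local] Hint Resolve class1_closed class_inv_closed class_inv_but_closed : core.
#[local] Hint Resolve class0_closed class_ninv_closed : core.

(** If no irreducible factor is in a class other than that of a unit, the
    product is in the class of a unit. *)
Lemma mult_class_inv_eq0 a : a != 0 -> inv (pi a) -> mult class_inv a = 0%N ->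
  sim (pi a) 1.
Proof.
elim/(factor_ind R_UFD) => [u uU _ _|p c pI c0 IH]; first exact: sim_unit.
rewrite rmorphM invM multM ?(irreducible_neq0 pI) // mult_irreducible //.
move=> -[pi_ ci] /eqP; rewrite addn_eq0 eqb0 => /andP[/asboolPn p1 /eqP c1].
have [p1'|/(conj pi_) //] := pselect (sim (pi p) 1).
exact: sim_trans (sim_mul1 _ (IH ci c1)) p1'.
Qed.

Lemma mult_le P1 P2 a : subpred P1 P2 -> (mult P1 a <= mult P2 a)%N.
Proof. by move=> s; apply: sub_count. Qed.

Lemma mult_ninv_eq0 a : a != 0 -> mult class0 a = 0%N ->
  mult class_ninv a = 0%N -> inv (pi a).
Proof.
elim/(factor_ind R_UFD) => [u uU _ _|p c pI c0 IH]; first exact: inv_pi.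
rewrite !multM ?(irreducible_neq0 pI) // !(mult_irreducible R_UFD _ pI) //.
rewrite rmorphM invM.
move=> /eqP; rewrite addn_eq0 eqb0 => /andP[/asboolPn p0 /eqP c0'].
move=> /eqP; rewrite addn_eq0 eqb0 => /andP[/asboolPn pn /eqP cn].
split; last exact: IH.
by have [//|pni] := pselect (inv (pi p)); case: pn; split=> //; apply/eqP.
Qed.

Lemma class0_mult a : a != 0 -> pi a != 0 -> mult class0 a = 0%N.
Proof.
move=> a0 pa; case: (posnP (mult class0 a)) => //.
move=> /(mult_gt0P R_UFD class0_closed a0)[p [c [e _ /asboolP p0 _]]].
by move: pa; rewrite e rmorphM p0 mul0r eqxx.
Qed.

Lemma tau_factorization_mult P m u bs : assoc_closed P ->
  tau_factorization I m u bs -> mult P m = (\sum_(b <- bs) mult P b)%N.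
Proof.
move=> Pc [uU _ bsN _ ->]; have bs0 : {in bs, forall b, b != 0}.
  by move=> b /bsN[].
have u0 : u != 0 by apply: contraTneq uU => ->; rewrite unitr0.
rewrite multM //; first by rewrite (mult_unit R_UFD Pc uU) mult_prod.
by rewrite prodf_seq_neq0; apply/allP => b /bs0.
Qed.

Lemma tau_factorization_mult_const P m u bs k : assoc_closed P ->
  tau_factorization I m u bs -> {in bs, forall b, mult P b = k} ->
  mult P m = (size bs * k)%N.
Proof.
move=> Pc mF bsk; rewrite (tau_factorization_mult Pc mF).
rewrite big_seq (eq_bigr (fun=> k)) // -big_seq big_const_seq count_predT.
by rewrite iter_addn_0 mulnC.
Qed.

(** All factors have the same class, so the product is invertible modulo [I]
    exactly when that common class is. *)
Lemma tau_factorization_pi m u bs : tau_factorization I m u bs ->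
  exists2 x, {in bs, forall b, pi b = x} & (inv (pi m) <-> inv x).
Proof.
case=> uU; case: bs => [//|b0 bs] _ _ bsI ->; exists (pi b0).
  by move=> b bI; apply/pi_eq/bsI => //; apply: mem_head.
have {}bsI : {in bs, forall b, pi b = pi b0}.
  by move=> b bI; apply/pi_eq/bsI; rewrite ?mem_head // inE bI orbT.
rewrite rmorphM invM big_cons rmorphM invM; split=> [[_ []]|b0i] //.
split; first exact: inv_pi.
split=> //; rewrite rmorph_prod big_seq.
elim/big_ind: (\prod_(_ <- _ | _) _) => [|x y xi yi|b /bsI -> //].
  exact: inv1.
exact/invM.
Qed.

(** * Local residue rings: unique lengths *)

(* The hypotheses hold in every local ring with four elements: the units form a
   group of order at most 3, and the maximal ideal has square zero and at most
   one nonzero element. *)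
Section LocalResidueRing.
Hypothesis inv_class : forall x y,
  inv x -> inv y -> x != 1 -> y != 1 -> x != y -> x * y = 1 /\ y = x * x.
Hypothesis ninvM : forall x y, ~ inv x -> ~ inv y -> x * y = 0.
Hypothesis ninv_uniq : forall x y,
  ~ inv x -> ~ inv y -> x != 0 -> y != 0 -> x = y.

Lemma sim_inv_class x y : inv x -> inv y -> ~ sim x 1 -> ~ sim y 1 ->
  ~ sim x y -> x * y = 1 /\ y = x * x.
Proof.
by move=> xi yi x1 y1 xy; apply: inv_class => //; apply/eqP => e; 
  [apply: x1|apply: y1|apply: xy]; rewrite e; apply: sim_refl.
Qed.

(** Let y be the common class of p and q. If the class w of d is ~ 1, split as
    p (q d); if w ~ y, split as p q d; otherwise y and w are the two
    nontrivial classes of a group of order 3, w = y^2, and (p q) d is a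
    splitting. *)
Lemma two_sim_primes_not_atom p q d :
  nonzero_nonunit p -> nonzero_nonunit q -> d != 0 -> inv (pi (p * (q * d))) ->
  ~ sim (pi p) 1 -> sim (pi p) (pi q) -> ~ tau_atom I (p * (q * d)).
Proof.
move=> pN qN d0; rewrite !rmorphM !invM => -[pi_ [qi di]] p1 pq.
have [d1|d1] := pselect (sim (pi d) 1).
  apply: tau_atom_split2 => //; first exact: nonzero_nonunitM.
  by rewrite rmorphM; apply: sim_trans pq _; apply/sim_sym/sim_mul1.
have dN := nonunit_nsim1 d0 d1.
have [pd|pd] := pselect (sim (pi p) (pi d)).
  by apply: tau_atom_split3 => //; apply: sim_trans (sim_sym pq) pd.
have [_ e] := sim_inv_class pi_ di p1 d1 pd.
rewrite mulrA; apply: tau_atom_split2 => //.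
  by apply: nonzero_nonunitM => //; case: qN.
by rewrite rmorphM e; apply: simM; [exact: sim_refl|exact: sim_sym].
Qed.

(** Were there two irreducible factors p, q in classes not ~ 1, these classes
    would be inequivalent by [two_sim_primes_not_atom], hence inverse to each
    other and each the square of the other. Writing a = p q d, the class of d
    is that of a; it is ~ to the class of p or of q, so q (p d) or p (q d) is a
    splitting. *)
Lemma class_inv_atom a : tau_atom I a -> inv (pi a) -> ~ sim (pi a) 1 ->
  mult class_inv a = 1%N /\
  forall z, sim (pi a) z -> mult (class_inv_but z) a = 0%N.
Proof.
move=> aA ai a1; have [[a0 _] _] := aA.
have /(mult_gt0P R_UFD class_inv_closed a0) : (0 < mult class_inv a)%N.
  by rewrite lt0n; apply/eqP => /(mult_class_inv_eq0 a0 ai).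
case=> p [c [e pI pcl c0]].
have /asboolP[pi_ p1] := pcl.
have p0 := irreducible_neq0 pI.
have pN := irreducible_nonzero_nonunit pI.
move: ai; rewrite e rmorphM invM => -[_ ci].
have [c1|] := eqVneq (mult class_inv c) 0%N.
  have sc := mult_class_inv_eq0 c0 ci c1.
  split; first by rewrite multM // mult_irreducible // pcl c1.
  move=> z sz; have cz : mult (class_inv_but z) c = 0%N.
    apply/eqP; rewrite -leqn0 -c1; apply: mult_le => b /asboolP[*].
    exact/asboolP.
  rewrite multM // mult_irreducible // cz addn0; apply/eqP; rewrite eqb0.
  apply/asboolPn => -[_ _]; apply; apply: sim_trans sz.
  exact/sim_sym/sim_mul1.
rewrite -lt0n => /(mult_gt0P R_UFD class_inv_closed c0)[q [d [ec qI qcl d0]]].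
have /asboolP[qi q1] := qcl.
have qN := irreducible_nonzero_nonunit qI.
have q0 := irreducible_neq0 qI.
have ai : inv (pi (p * (q * d))) by rewrite -ec rmorphM invM.
rewrite {}ec in e ci c0; exfalso.
have [pq|pq] := pselect (sim (pi p) (pi q)).
  by apply: (@two_sim_primes_not_atom p q d) => //; rewrite -e.
have [pq1 pqE] := sim_inv_class pi_ qi p1 q1 pq.
have [_ qpE] : pi q * pi p = 1 /\ pi p = pi q * pi q.
  by apply: sim_inv_class => // /sim_sym.
have ad : pi a = pi d by rewrite e !rmorphM mulrA pq1 mul1r.
move: (a1) (ai); rewrite -e => a1' aii.
have [pa|pa] := pselect (sim (pi p) (pi a)).
  apply: (@tau_atom_split2 q (p * d)) => //; first exact: nonzero_nonunitM.
  - rewrite rmorphM pqE -ad; apply: simM => //; exact: sim_refl.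
  - by rewrite mulrCA -e.
have [pa1 paE] := sim_inv_class pi_ aii p1 a1' pa.
have aq : pi a = pi q.
  by rewrite -[LHS]mul1r -pq1 mulrAC pa1 mul1r.
apply: (@tau_atom_split2 p (q * d)) => //; first exact: nonzero_nonunitM.
- by rewrite rmorphM -ad aq {1}qpE; apply: sim_refl.
- by rewrite -e.
Qed.

(** A factor in class ~ 1 splits off unless the cofactor is a unit. If there is
    none, two irreducible factors p, q are in classes not ~ 1, necessarily
    inequivalent and so inverse to each other; then p q splits off. Since no
    class is ~ to both, every z misses one of p and q. *)
Lemma class1_atom a : tau_atom I a -> sim (pi a) 1 ->
  (mult class1 a = 1%N /\ mult class_inv a = 0%N) \/
  [/\ mult class1 a = 0%N, mult class_inv a = 2%N &
      forall z, (0 < mult (class_inv_but z) a)%N].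
Proof.
move=> aA a1; have ai := sim1_inv a1; have aN := aA.1; have [a0 _] := aN.
have [/eqP n1|] := posnP (mult class1 a); last first.
  move=> /(mult_gt0P R_UFD class1_closed a0)[p [c [e pI pcl c0]]].
  have p1 : sim (pi p) 1 by apply/asboolP.
  have c1 : sim (pi c) 1.
    apply: sim_trans a1; rewrite e rmorphM mulrC; exact/sim_sym/sim_mul1.
  have [cU|cN] := boolP (c \is a GRing.unit).
    left; rewrite e !multM ?(irreducible_neq0 pI) // !(mult_unit R_UFD _ cU) //.
    rewrite !mult_irreducible // pcl (_ : class_inv p = false) //.
    by apply/asboolPn => -[].
  exfalso; apply: (@tau_atom_split2 p c) => //; rewrite -?e //.
    exact: irreducible_nonzero_nonunit.
  exact/(sim_trans p1)/sim_sym.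
right; have [p [c [e pI c0]]] := nonzero_nonunit_factor R_UFD aN.
have p0 := irreducible_neq0 pI.
have pN := irreducible_nonzero_nonunit pI.
have [pi_ ci] : inv (pi p) /\ inv (pi c) by apply/invM; rewrite -rmorphM -e.
have p1 : ~ sim (pi p) 1.
  move=> p1; move: n1; rewrite e multM // mult_irreducible //.
  by rewrite (_ : class1 p) //; apply/asboolP.
have c1 : ~ sim (pi c) 1.
  move=> c1; apply: p1; apply: sim_trans a1.
  by rewrite e rmorphM; exact/sim_sym/sim_mul1.
have /(mult_gt0P R_UFD class_inv_closed c0) : (0 < mult class_inv c)%N.
  by rewrite lt0n; apply/eqP => /(mult_class_inv_eq0 c0 ci).
case=> q [d [ec qI qcl d0]].
have /asboolP[qi q1] := qcl.
have pcl : class_inv p by apply/asboolP.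
have qN := irreducible_nonzero_nonunit qI.
have q0 := irreducible_neq0 qI.
rewrite {}ec in e ci c0 c1.
have [pq|pq] := pselect (sim (pi p) (pi q)).
  by exfalso; apply: (@two_sim_primes_not_atom p q d) => //; rewrite -e.
have [pq1 _] := sim_inv_class pi_ qi p1 q1 pq.
have ad : pi a = pi d by rewrite e !rmorphM mulrA pq1 mul1r.
have [dU|dN] := boolP (d \is a GRing.unit); last first.
  exfalso; apply: (@tau_atom_split2 (p * q) d) => //.
  - exact: nonzero_nonunitM.
  - by rewrite rmorphM pq1 -ad; apply: sim_sym.
  - by rewrite -mulrA -e.
split; first exact/eqP.
  rewrite e !multM //.
  by rewrite (mult_unit R_UFD _ dU) // !mult_irreducible // pcl qcl.
move=> z; rewrite e !multM //.
rewrite (mult_unit R_UFD _ dU) // !mult_irreducible // !addn_gt0.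
have [pz|pz] := pselect (sim (pi p) z); last first.
  by rewrite (_ : class_inv_but z p) //; apply/asboolP.
rewrite (_ : class_inv_but z q) ?orbT //; apply/asboolP; split=> //.
by move=> qz; apply: pq; apply: sim_trans pz (sim_sym qz).
Qed.

(** A product of two noninvertible classes is 0, so at most one irreducible
    factor has a noninvertible class. *)
Lemma mult_class_ninv a : a != 0 -> ~ inv (pi a) -> pi a != 0 ->
  mult class_ninv a = 1%N.
Proof.
move=> a0 ai pa; have a00 := class0_mult a0 pa.
have /(mult_gt0P R_UFD class_ninv_closed a0) : (0 < mult class_ninv a)%N.
  by rewrite lt0n; apply/eqP => /(mult_ninv_eq0 a0 a00).
case=> p [c [e pI pcl c0]]; have /asboolP[pn _] := pcl.
rewrite e multM ?(irreducible_neq0 pI) // mult_irreducible // pcl.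
case: (posnP (mult class_ninv c)) => [-> //|].
move=> /(mult_gt0P R_UFD class_ninv_closed c0)[q [d [ec _ /asboolP[qn _] _]]].
by move: pa; rewrite e ec !rmorphM mulrA (ninvM pn qn) mul0r eqxx.
Qed.

(** Two factors in class 0 give a splitting into two elements of class 0. If
    there is none, at least two irreducible factors p, q are in the nonzero
    noninvertible class t, as a unit multiple of t is not 0. Writing
    a = p q d, split as p (q d), (p q) d or p q d according as the class of d is
    invertible, 0 or t. *)
Lemma class0_atom a : tau_atom I a -> pi a = 0 -> mult class0 a = 1%N.
Proof.
move=> aA pa; have [[a0 _] _] := aA.
have [z0|] := posnP (mult class0 a); last first.
  move=> /(mult_gt0P R_UFD class0_closed a0)[p [c [e pI pcl c0]]].
  have /asboolP p0 := pcl.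
  rewrite e multM ?(irreducible_neq0 pI) // mult_irreducible // pcl.
  case: (posnP (mult class0 c)) => [-> //|].
  move=> /(mult_gt0P R_UFD class0_closed c0)[q [d [ec qI /asboolP q0 d0]]].
  exfalso; apply: (@tau_atom_split2 p (q * d)); rewrite -?ec -?e //.
  - exact: irreducible_nonzero_nonunit.
  - by rewrite ec; apply: nonzero_nonunitM => //; apply: irreducible_nonzero_nonunit.
  - by rewrite ec rmorphM p0 q0 mul0r; apply: sim_refl.
exfalso; have /(mult_gt0P R_UFD class_ninv_closed a0) : (0 < mult class_ninv a)%N.
  by rewrite lt0n; apply/eqP => /(mult_ninv_eq0 a0 z0); rewrite pa => /inv0.
case=> p [c [e pI /asboolP[pn p0] c0]].
have pN := irreducible_nonzero_nonunit pI.
have z0c : mult class0 c = 0%N.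
  by move/eqP: z0; rewrite e multM ?(irreducible_neq0 pI) // addn_eq0 => /andP[_ /eqP].
have [tc|] := posnP (mult class_ninv c).
  have [w cw] := mult_ninv_eq0 c0 z0c tc.
  move: p0; rewrite -[pi p]mulr1 -cw mulrA -rmorphM -e pa mul0r eqxx //.
move=> /(mult_gt0P R_UFD class_ninv_closed c0)[q [d [ec qI /asboolP[qn q0] d0]]].
have qN := irreducible_nonzero_nonunit qI.
have pq := ninv_uniq pn qn p0 q0.
rewrite {}ec in e c0 z0c.
have [di|dn] := pselect (inv (pi d)).
  apply: (@tau_atom_split2 p (q * d)); rewrite -?e //.
    exact: nonzero_nonunitM.
  rewrite (@ninv_uniq (pi p) (pi (q * d))) //; first exact: sim_refl.
    by rewrite rmorphM => /invM[].
  have [w dw] := di; apply: contraNneq q0.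
  by move=> qd0; rewrite -[pi q]mulr1 -dw mulrA -rmorphM qd0 mul0r.
have dN := nonunit_ninv d0 dn.
have [d00|d00] := eqVneq (pi d) 0.
  apply: (@tau_atom_split2 (p * q) d); rewrite -?mulrA -?e //.
    by apply: nonzero_nonunitM => //; case: qN.
  by rewrite rmorphM (ninvM pn qn) d00; apply: sim_refl.
apply: (@tau_atom_split3 p q d); rewrite -?e //.
  by rewrite pq; apply: sim_refl.
by rewrite (ninv_uniq qn dn q0 d00); apply: sim_refl.
Qed.

(** The first case is a factorization in a class z not ~ 1; the second is one in
    the class ~ 1, where each atom contributes 2 to 2 N_1 + N, with N_1 and N
    the numbers of irreducible factors in classes ~ 1 and not ~ 1. The clauses
    about [class_inv_but] make the cases incompatible: every irreducible factor
    not ~ 1 is ~ z in the first, while two inequivalent ones occur in the second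
    as soon as N > 0. *)
Lemma unit_class_length m k : has_atomic_factorization I m k -> inv (pi m) ->
  (mult class_inv m = k /\ exists z, mult (class_inv_but z) m = 0%N) \/
  (k.*2 = (mult class1 m).*2 + mult class_inv m /\
    (mult class_inv m = 0 \/ forall z, 0 < mult (class_inv_but z) m))%N.
Proof.
move=> [u [bs [mF bsA <-]]] mi.
have [x bsx /iffLR/(_ mi) xi] := tau_factorization_pi mF.
have [x1|x1] := pselect (sim x 1); last first.
  left; have bsC b : b \in bs -> _ := fun bI => @class_inv_atom b (bsA b bI).
  split.
    rewrite (tau_factorization_mult_const (k := 1%N) _ mF) ?muln1 //.
    by move=> b bI; case: (bsC b bI); rewrite ?bsx.
  exists x; rewrite (tau_factorization_mult_const (k := 0%N) _ mF) ?muln0 //.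
  move=> b bI; case: (bsC b bI); rewrite ?bsx // => _; apply.
  exact: sim_refl.
right; have bsC b : b \in bs -> _ := fun bI => @class1_atom b (bsA b bI).
have {}bsC b : b \in bs -> _ := fun bI => bsC b bI ltac:(by rewrite bsx).
split.
  rewrite !(tau_factorization_mult _ mF) // -!muln2 big_distrl /= -big_split /=.
  rewrite big_seq (eq_bigr (fun=> 2%N)) -?big_seq ?big_const_seq ?count_predT.
    by rewrite iter_addn_0 mulnC.
  by move=> b /bsC[[-> ->]|[-> ->]].
have [bs0|/allPn[b bI bn]] := boolP (all (fun b => mult class_inv b == 0%N) bs).
  left; rewrite (tau_factorization_mult_const (k := 0%N) _ mF) ?muln0 //.
  by move=> b /(allP bs0)/eqP.
right=> z; rewrite (tau_factorization_mult _ mF) // (big_rem b) //= addn_gt0.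
by case: (bsC b bI) => [[_ b0]|[_ _ ->] //]; rewrite b0 in bn.
Qed.

Lemma nonunit_class_length m k :
  has_atomic_factorization I m k -> ~ inv (pi m) ->
  k = if (0 < mult class0 m)%N then mult class0 m else mult class_ninv m.
Proof.
move=> [u [bs [mF bsA <-]]] mi.
have [x bsx mx] := tau_factorization_pi mF.
have xi : ~ inv x by move/mx.
have bs_gt0 : (0 < size bs)%N by case: mF.
have bs0 b : b \in bs -> b != 0 by move=> /bsA[[]].
have [x0|x0] := eqVneq x 0.
  have -> : mult class0 m = size bs; last by rewrite bs_gt0.
  rewrite (tau_factorization_mult_const (k := 1%N) _ mF) ?muln1 //.
  by move=> b bI; apply: class0_atom; rewrite ?bsx //; apply: bsA.
rewrite (tau_factorization_mult_const (k := 0%N) class0_closed mF) ?muln0 /=.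
  rewrite (tau_factorization_mult_const (k := 1%N) _ mF) ?muln1 //.
  by move=> b bI; apply: mult_class_ninv; rewrite ?bsx ?bs0.
by move=> b bI; apply: class0_mult; rewrite ?bsx ?bs0.
Qed.

Lemma local_length_unique m k l : has_atomic_factorization I m k ->
  has_atomic_factorization I m l -> k = l.
Proof.
move=> mk ml; have [mi|mi] := pselect (inv (pi m)); last first.
  by rewrite (nonunit_class_length mk mi) (nonunit_class_length ml mi).
have sub z : (mult (class_inv_but z) m <= mult class_inv m)%N.
  by apply: mult_le => b /asboolP[*]; apply/asboolP.
have pos n : has_atomic_factorization I m n -> (0 < n)%N.
  by case=> u [bs [[_ bs0 _ _ _] _ <-]].
have := pos _ mk; have := pos _ ml.
case: (unit_class_length mk mi) => [[<- [z z0]]|[ek hk]];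
  case: (unit_class_length ml mi) => [[<- [w w0]]|[el hl]] // m0 n0.
- by case: hl => [c0|/(_ z)]; [rewrite c0 in n0|rewrite z0].
- by case: hk => [c0|/(_ w)]; [rewrite c0 in m0|rewrite w0].
- by apply: double_inj; rewrite ek el.
Qed.

End LocalResidueRing.

(** * Residue ring F_2 x F_2: unbounded lengths *)

Section KleinResidueRing.
Implicit Types e f : Q.

Lemma klein_inv e x : klein e -> inv x -> x = 1.
Proof. by move=> Ke [y xy]; rewrite -[LHS]mulr1 -xy mulrA (klein_idem Ke). Qed.

Lemma klein_unit e u : klein e -> u \is a GRing.unit -> pi u = 1.
Proof. by move=> Ke /inv_pi; apply: klein_inv Ke. Qed.

Lemma klein_sim e x y : klein e -> sim x y -> x = y.
Proof. by move=> Ke [u uU ->]; rewrite (klein_unit Ke uU) mul1r. Qed.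

Lemma classes_klein_closed e K : klein e -> assoc_closed (classes K).
Proof. by move=> Ke; apply: classes_closed => x y /(klein_sim Ke) ->. Qed.

(** In a product of classes equal to e no factor is 0 or 1 + e, because
    e (1 + e) = 0; as e is not 1, some factor is e. *)
Lemma klein_class_prime e : klein e -> (exists a, pi a = e) ->
  exists2 p, irreducible_elt p & pi p = e.
Proof.
move=> Ke [a ae]; have [_ _ e0 e1 _] := Ke.
have a0 : a != 0 by apply: contraNneq e0 => a0; rewrite -ae a0 rmorph0.
elim/(factor_ind R_UFD): a / a0 ae => [u uU|p c pI c0 IH] pe.
  by move: e1; rewrite -pe (klein_unit Ke uU) eqxx.
move: pe; rewrite rmorphM; case: (Ke) => _ _ _ _ /(_ (pi p))[] pp.
- by rewrite pp mul0r => e0'; rewrite -e0' eqxx in e0.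
- by rewrite pp mul1r.
- by move=> _; exists p.
- rewrite pp => h; move: e0.
  by rewrite -(klein_idem Ke e) -{2}h mulrA (klein_mul_compl Ke) mul0r eqxx.
Qed.

Definition class_eq x := classes (fun y => y = x).

(** Without factors in the classes 0 and e, the product is 1 or 1 + e. *)
Lemma klein_mult_gt0 e a : klein e -> a != 0 -> pi a = 0 ->
  mult class0 a = 0%N -> (0 < mult (class_eq e) a)%N.
Proof.
move=> Ke a0 pa z0; rewrite lt0n; apply/negP => /eqP ez.
have ec : assoc_closed (class_eq e) by apply: classes_klein_closed Ke.
suff [] : pi a = 1 \/ pi a = 1 + e.
  by rewrite pa => /esym/eqP; rewrite oner_eq0.
  by rewrite pa => /esym/eqP; rewrite (negPf (klein_compl_neq0 Ke)).
elim/(factor_ind R_UFD): a / a0 z0 ez {pa} => [u uU|p c pI c0 IH].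
  by left; apply: klein_unit Ke uU.
rewrite !multM ?(irreducible_neq0 pI) // !(mult_irreducible R_UFD _ pI) //.
move=> /eqP; rewrite addn_eq0 eqb0 => /andP[/asboolPn p0 /eqP c0'].
move=> /eqP; rewrite addn_eq0 eqb0 => /andP[/asboolPn pe /eqP ce].
rewrite rmorphM; have [_ _ _ _ /(_ (pi p))[]//pp] := Ke;
  rewrite pp; case: (IH c0' ce) => ->; rewrite ?mulr1 ?mul1r ?(klein_idem Ke);
  by [left|right].
Qed.

Section TwoPrimes.
Variables (e : Q) (p q : R).
Hypotheses (Ke : klein e) (pI : irreducible_elt p) (qI : irreducible_elt q).
Hypotheses (pe : pi p = e) (qe : pi q = 1 + e).

Let pN := irreducible_nonzero_nonunit pI.
Let qN := irreducible_nonzero_nonunit qI.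
Let p0 := irreducible_neq0 pI.
Let q0 := irreducible_neq0 qI.

Lemma klein_expr (x : Q) n : x ^+ n.+1 = x.
Proof. by elim: n => [//|n IH]; rewrite exprS IH (klein_idem Ke). Qed.

Lemma pi_primes_prod i j : pi (p ^+ i.+1 * q ^+ j.+1) = 0.
Proof. by rewrite rmorphM !rmorphXn /= pe qe !klein_expr (klein_mul_compl Ke). Qed.

Lemma primes_prod_nonzero_nonunit i j :
  nonzero_nonunit (p ^+ i.+1 * q ^+ j.+1).
Proof.
apply: nonzero_nonunitM; last by rewrite expf_neq0.
by rewrite exprS; apply: nonzero_nonunitM => //; rewrite expf_neq0.
Qed.

Lemma mult_primes_prod P i j : assoc_closed P ->
  mult P (p ^+ i * q ^+ j) = (i * P p + j * P q)%N.
Proof.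
move=> Pc; have X (r : R) n : irreducible_elt r -> mult P (r ^+ n) = (n * P r)%N.
  move=> rI; have r0 := irreducible_neq0 rI.
  elim: n => [|n IH]; first by rewrite mult_unit ?unitr1.
  by rewrite exprS multM ?expf_neq0 // mult_irreducible // IH mulSn.
by rewrite multM ?expf_neq0 // !X.
Qed.

(** The common class of the factors is idempotent and their product is 0, so it
    is 0; since p and q are the only irreducible factors available, each factor
    contains one of class f, by [klein_mult_gt0]. *)
Lemma tau_factorization_size_le f i j u bs : klein f ->
  tau_factorization I (p ^+ i.+1 * q ^+ j.+1) u bs ->
  (size bs <= mult (class_eq f) (p ^+ i.+1 * q ^+ j.+1))%N.
Proof.
move=> Kf mF; have [x bsx _] := tau_factorization_pi mF.
have fc : assoc_closed (class_eq f) by apply: classes_klein_closed Kf.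
have [uU bs_gt0 bsN _ mE] := mF.
have prodx : pi (\prod_(b <- bs) b) = x.
  case: bs bs_gt0 bsx {mF bsN mE} => [//|b bs] _ bsx.
  rewrite big_cons rmorphM bsx ?mem_head //.
  have {}bsx : {in bs, forall b, pi b = x}.
    by move=> c cI; apply: bsx; rewrite inE cI orbT.
  elim: bs bsx => [|c bs IH] bsx; first by rewrite big_nil rmorph1 mulr1.
  rewrite big_cons rmorphM mulrA bsx ?mem_head // (klein_idem Ke) IH //.
  by move=> d dI; apply: bsx; rewrite inE dI orbT.
have x0 : x = 0.
  by rewrite -prodx -[LHS]mul1r -(klein_unit Ke uU) -rmorphM -mE pi_primes_prod.
have m0 : mult class0 (p ^+ i.+1 * q ^+ j.+1) = 0%N.
  have [_ _ e0 _ _] := Ke.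
  rewrite mult_primes_prod // (_ : class0 p = false); last first.
    by apply/asboolPn; rewrite pe; apply/eqP.
  rewrite (_ : class0 q = false) ?muln0 //.
  by apply/asboolPn; rewrite qe; apply/eqP/klein_compl_neq0.
rewrite (tau_factorization_mult fc mF) -sum1_size !big_seq.
apply: leq_sum => b bI; apply: klein_mult_gt0 => //; first by case: (bsN b bI).
  by rewrite bsx.
apply/eqP; rewrite -leqn0 -[X in (_ <= X)%N]m0 (tau_factorization_mult _ mF) //.
by rewrite (big_rem b) //= leq_addr.
Qed.

Lemma primes_prod_atom i j : (i == 0%N) || (j == 0%N) ->
  tau_atom I (p ^+ i.+1 * q ^+ j.+1).
Proof.
move=> ij; split; first exact: primes_prod_nonzero_nonunit.
move=> u bs mF; have [_ bs_gt0 _ _ _] := mF.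
apply/eqP; rewrite eqn_leq bs_gt0 andbT.
have ne : e != 1 + e by rewrite -subr_eq0 opprD addrCA subrr addr0 oppr_eq0 oner_eq0.
have ep : class_eq e p by apply/asboolP.
have eq : class_eq e q = false by apply/asboolPn; rewrite qe => /eqP; rewrite eq_sym (negPf ne).
have fp : class_eq (1 + e) p = false by apply/asboolPn; rewrite pe; apply/eqP.
have fq : class_eq (1 + e) q by apply/asboolP.
have cl x : assoc_closed (class_eq x) by apply: classes_klein_closed Ke.
have := tau_factorization_size_le Ke mF.
have := tau_factorization_size_le (klein_sym Ke) mF.
rewrite !mult_primes_prod // ep eq fp fq !muln0 !muln1 addn0 add0n.
by case/orP: ij => /eqP ->.
Qed.

Lemma primes_power_factorizations k :
  has_atomic_factorization I ((p * q) ^+ k.+2) k.+2 /\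
  has_atomic_factorization I ((p * q) ^+ k.+2) 2.
Proof.
have eqI (a b : R) : pi a = 0 -> pi b = 0 -> a - b \in I.
  by move=> pa pb; apply/pi_eq; rewrite pa pb.
have pq0 : pi (p * q) = 0 by rewrite -[p]expr1 -[q]expr1 pi_primes_prod.
split.
- exists 1, (nseq k.+2 (p * q)); rewrite size_nseq; split=> //.
    split=> //; first exact: unitr1.
    + by move=> b /nseqP[-> _]; apply: nonzero_nonunitM.
    + by move=> b c /nseqP[-> _] /nseqP[-> _]; apply: eqI.
    + by rewrite mul1r big_nseq iter_mulr_1.
  move=> b /nseqP[-> _]; rewrite -[p]expr1 -[q]expr1.
  exact: (@primes_prod_atom 0 0).
- exists 1, [:: p ^+ 1 * q ^+ k.+1; p ^+ k.+1 * q ^+ 1]; split=> //.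
    split=> //; first exact: unitr1.
    + by move=> b; rewrite !inE => /orP[] /eqP ->; apply: primes_prod_nonzero_nonunit.
    + by move=> b c; rewrite !inE => /orP[] /eqP -> /orP[] /eqP ->;
        apply: eqI; apply: pi_primes_prod.
    + by rewrite mul1r big_cons big_seq1 mulrACA -!exprD addn1 add1n exprMn.
  by move=> b; rewrite !inE => /orP[] /eqP ->; apply: primes_prod_atom;
    rewrite ?eqxx ?orbT.
Qed.

End TwoPrimes.
End KleinResidueRing.
End ResidueClasses.

(** * Commutative rings with four elements *)

Section FourElements.
Variables (Q : comNzRingType).
Implicit Types x y : Q.

Lemma card4_cover : ([set: Q] #= `I_4)%card -> exists s : seq Q,
  [/\ size s = 2, uniq [:: 0, 1 & s] & forall x, x \in [:: 0, 1 & s]].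
Proof.
move=> /card_set_bijP[f [ffun finj fsurj]].
have {}finj : injective f by move=> x y; apply: finj; rewrite inE.
have /choice[g gE] : forall i, exists x, (i < 4)%N -> f x = i.
  move=> i; have [i4|_] := boolP (i < 4)%N; last by exists 0.
  by have [x _ <-] := fsurj i i4; exists x.
have fsurj' x : x \in map g (iota 0 4).
  have fx4 : (f x < 4)%N by apply: ffun.
  apply/mapP; exists (f x); first by rewrite mem_iota.
  by apply: finj; rewrite gE.
have szg : size (map g (iota 0 4)) = 4 by [].
have ug : uniq (map g (iota 0 4)).
  rewrite map_inj_in_uniq ?iota_uniq // => i j; rewrite !mem_iota => i4 j4 gij.
  by rewrite -(gE i i4) gij gE.
move: (map g (iota 0 4)) fsurj' szg ug => s sP ss us.
exists (rem 1 (rem 0 s)); have m1 : 1 \in rem 0 s.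
  by rewrite mem_rem_uniq // inE oner_eq0 sP.
have p : perm_eq s [:: 0, 1 & rem 1 (rem 0 s)].
  apply: perm_trans (perm_to_rem (sP 0)) _.
  by rewrite perm_cons perm_to_rem.
split; first by rewrite !size_rem // ss.
  by rewrite -(perm_uniq p).
by move=> x; rewrite -(perm_mem p).
Qed.

Variables al be : Q.
Hypothesis uQ : uniq [:: 0; 1; al; be].
Hypothesis cQ : forall x, x \in [:: 0; 1; al; be].

Lemma cover4 x y : inv x -> inv y -> x != 1 -> y != 1 -> x != y ->
  forall z, [\/ z = 0, z = 1, z = x | z = y].
Proof.
have n0 (z : Q) : inv z -> z != 0 by move=> zi; apply/eqP => z0; rewrite z0 in zi; exact: inv0 zi.
move=> /n0 x0 /n0 y0 x1 y1 xy z; have := cQ z; have := cQ x; have := cQ y.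
rewrite !inE (negPf x0) (negPf x1) (negPf y0) (negPf y1) /=.
move=> /orP[]/eqP ey /orP[]/eqP ex; move: xy; rewrite ?ex ?ey ?eqxx // => _.
  by case/or4P => /eqP ->; [constructor 1|constructor 2|constructor 4|constructor 3].
by case/or4P => /eqP ->; [constructor 1|constructor 2|constructor 3|constructor 4].
Qed.

Lemma inv_mulI x y z : inv x -> x * y = x * z -> y = z.
Proof.
move=> [w xw] e; have : w * (x * y) = w * (x * z) by rewrite e.
by rewrite !mulrA (mulrC w) xw !mul1r.
Qed.

(** Here Q = {0, 1, x, y} is a field, and x y and x^2 are found by excluding
    the values that cancellation forbids. *)
Lemma inv_class4 x y :
  inv x -> inv y -> x != 1 -> y != 1 -> x != y -> x * y = 1 /\ y = x * x.
Proof.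
move=> xi yi x1 y1 xy; have c := cover4 xi yi x1 y1 xy.
have n0 (z w : Q) : inv z -> inv w -> z * w = 0 -> False.
  by move=> zi wi zw; have /invM := conj zi wi; rewrite zw => /inv0.
have xy1 : x * y = 1.
  case: (c (x * y)) => // e; first by case: (n0 _ _ xi yi e).
  - by case/eqP: y1; apply: (inv_mulI xi); rewrite mulr1.
  - by case/eqP: x1; apply: (inv_mulI yi); rewrite mulr1 mulrC.
split=> //; case: (c (x * x)) => // e; first by case: (n0 _ _ xi xi e).
- by case/eqP: xy; apply: (inv_mulI xi); rewrite e.
- by case/eqP: x1; apply: (inv_mulI xi); rewrite mulr1.
Qed.

(** Only be^2 = 0 needs an argument. Otherwise be would be idempotent, and
    1 - be would be one of 0, 1, al, be, each of which is impossible. *)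
Lemma four_ninvM x y : inv al -> ~ inv x -> ~ inv y -> x * y = 0.
Proof.
move: uQ; rewrite /= !inE !negb_or -!andbA => /and4P[_ _ b0 /and4P[a1 b1 ab _]].
move=> ai.
have N z : ~ inv z -> z = 0 \/ z = be.
  by move: (cQ z); rewrite !inE => /or4P[]/eqP -> // => [|/(_ (inv1 _))|];
    [left|by []|right].
move=> xi yi; case: (N _ xi) => ex; first by rewrite ex mul0r.
case: (N _ yi) => ey; first by rewrite ey mulr0.
rewrite ex ey in xi yi *; move: (cQ (be * be)); rewrite !inE => /or4P[]/eqP // e.
- by case: xi; exists be.
- by case: xi; move: ai; rewrite -e => /invM[].
have bb : be * (1 - be) = 0 by rewrite mulrBr mulr1 e subrr.
move: (cQ (1 - be)); rewrite !inE => /or4P[]/eqP h.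
- by move/eqP: h; rewrite subr_eq0 (negPf b1).
- by move/eqP: h; rewrite -subr_eq0 addrAC subrr sub0r oppr_eq0 eq_sym (negPf b0).
- rewrite h in bb; case/eqP: b0.
  by apply: (inv_mulI ai); rewrite mulr0 mulrC bb.
- case: xi; exists (1 + 1); rewrite mulrDr mulr1.
  by rewrite -{1}h addrNK.
Qed.
Lemma four_ninv_uniq x y :
  inv al -> ~ inv x -> ~ inv y -> x != 0 -> y != 0 -> x = y.
Proof.
move=> ai; have i1 := inv1 Q.
by move: (cQ x) (cQ y); rewrite !inE => /or4P[]/eqP-> /or4P[]/eqP->; rewrite ?eqxx.
Qed.

(** As al is not invertible, 1 + al can only be be, and likewise 1 + be = al;
    this gives 2 = 0, and the other values of al^2 make al or be
    invertible. *)
Lemma four_klein : ~ inv al -> ~ inv be -> klein al.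
Proof.
move: uQ; rewrite /= !inE !negb_or -!andbA => /and4P[_ a0 b0 /and4P[a1 b1 ab _]].
move=> ai bi.
have oneD x y : ~ inv x -> (forall z, z \in [:: 0; 1; x; y]) -> x != 0 -> 1 + x = y.
  move=> xi c x0; move: (c (1 + x)); rewrite !inE => /or4P[]/eqP // h.
  - case: xi; exists (- 1); rewrite mulrN mulr1; apply/eqP.
    by rewrite eq_sym -addr_eq0 h.
  - by case/eqP: x0; apply: (addrI 1); rewrite addr0.
  - by have /eqP := addIr x (etrans h (esym (add0r x))); rewrite oner_eq0.
have ea : 1 + al = be by apply: oneD; rewrite // eq_sym.
have eb : 1 + be = al.
  apply: oneD; rewrite // 1?eq_sym // => z.
  by move: (cQ z); rewrite !inE; do !case: eqP.
have two : 1 + 1 = 0 :> Q.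
  by apply: (addIr al); rewrite -addrA ea eb add0r.
split=> //; rewrite 1?eq_sym //; last first.
  by move=> x; move: (cQ x); rewrite !inE ea => /or4P[]/eqP ->;
    [constructor 1|constructor 2|constructor 3|constructor 4].
move: (cQ (al * al)); rewrite !inE => /or4P[]/eqP // h.
- case: bi; exists be; rewrite -ea mulrDl mul1r mulrDr mulr1 h addr0.
  by rewrite -addrA -[al]mulr1 -mulrDr two mulr0 addr0.
- by case: ai; exists al.
- case: ai; exists (al - 1); rewrite mulrBr mulr1 h -ea addrK //.
Qed.

End FourElements.

Lemma four_elements_cases (Q : comNzRingType) : ([set: Q] #= `I_4)%card ->
  (exists e : Q, klein e) \/
  [/\ forall x y : Q, inv x -> inv y -> x != 1 -> y != 1 -> x != y ->
        x * y = 1 /\ y = x * x,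
      forall x y : Q, ~ inv x -> ~ inv y -> x * y = 0 &
      forall x y : Q, ~ inv x -> ~ inv y -> x != 0 -> y != 0 -> x = y].
Proof.
move=> /card4_cover[s [+ uQ cQ]].
case: s uQ cQ => [|al [|be [|? ?]]] // uQ cQ _.
have uQ' : uniq [:: 0; 1; be; al].
  rewrite (@perm_uniq _ _ [:: 0; 1; al; be]) //.
  by rewrite !perm_cons (perm_catC [:: be] [:: al]).
have cQ' x : x \in [:: 0; 1; be; al].
  by move: (cQ x); rewrite !inE; do !case: eqP.
have [ai|ai] := pselect (inv al).
  right; split=> x y.
  - exact: inv_class4 cQ x y.
  - exact: four_ninvM uQ cQ x y ai.
  - exact: four_ninv_uniq cQ x y ai.
have [bi|bi] := pselect (inv be).
  right; split=> x y.
  - exact: inv_class4 cQ x y.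
  - exact: four_ninvM uQ' cQ' x y bi.
  - exact: four_ninv_uniq cQ' x y bi.
by left; exists al; apply: four_klein cQ ai bi.
Qed.

(** * Elasticity from lengths *)

Section Elasticity.
Variables (K : realType) (R : idomainType) (I : {pred R}).

Lemma elasticity_eq1 :
  (forall m k l, has_atomic_factorization I m k ->
     has_atomic_factorization I m l -> k = l) ->
  elasticity I K = 1%E.
Proof.
move=> uniq_len; rewrite /elasticity; case: asboolP => // -[m0 m0A].
have elt m : tau_atomic I m -> elasticity_elt I K m = 1%E.
  move=> [k mk]; rewrite /elasticity_elt.
  have k0 : k%:R != 0 :> K.
    by case: mk => u [bs [[_ bs0 _ _ _] _ <-]]; rewrite pnatr_eq0 -lt0n.
  rewrite (_ : [set r | _]%classic = [set 1%E]%classic) ?ereal_sup1 //.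
  apply/seteqP; split=> [_ [k' [l [mk' ml ->]]]|_ ->] /=.
    by rewrite -(uniq_len _ _ _ mk mk') -(uniq_len _ _ _ mk ml) divff.
  by exists k, k; split=> //; rewrite divff.
rewrite (_ : [set _ | _ in _]%classic = [set 1%E]%classic) ?ereal_sup1 //.
apply/seteqP; split=> [_ [m mA <-]|_ ->]; first exact: elt.
by exists m0 => //; apply: elt.
Qed.

Lemma elasticity_eqy l : (0 < l)%N ->
  (forall n, exists m k, [/\ (n <= k)%N, has_atomic_factorization I m k &
                             has_atomic_factorization I m l]) ->
  elasticity I K = +oo%E.
Proof.
move=> l0 unb; rewrite /elasticity; case: asboolP => [_|[]]; last first.
  by have [m [k [_ mk _]]] := unb 0%N; exists m, k.
apply: eq_infty => r.
have [m [k [nk mk ml]]] := unb (Num.trunc (r * l%:R)).+1.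
apply: ereal_sup_ge; exists (elasticity_elt I K m).
  by exists m => //; exists k.
apply: ereal_sup_ge; exists (k%:R / l%:R)%:E; first by exists k, l.
rewrite lee_fin ler_pdivlMr ?ltr0n //.
by apply: le_trans (ltW (truncnS_gt _)) _; rewrite ler_nat.
Qed.

End Elasticity.

Local Open Scope quotient_scope.
Local Open Scope card_scope.

Theorem mainTheorem1 (K : realType) (R : idomainType) (I : idealr R)
    (R_UFD : is_UFD R)
    (card_quot : ([set: {ideal_quot I}]%classic #= `I_4)) :
  let two_primes_case :=
    (exists f : {rmorphism {ideal_quot I} -> {ideal_quot ideal_2_X2X}},
       bijective f) /\
    (forall c : {ideal_quot I}, c != 0 -> ~ (exists d, c * d = 1) ->
       exists2 p : R, prime_elt p & \pi_({ideal_quot I}) p = c) in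
  (two_primes_case -> elasticity I K = +oo%E) /\
  (~ two_primes_case -> elasticity I K = 1%E).
Proof.
pose pi := \pi_({ideal_quot I}) : {rmorphism R -> {ideal_quot I}}.
have pi_eq a b : a - b \in I <-> pi a = pi b.
  by rewrite Quotient.idealrBE; split=> /eqP.
have pi_surj x : exists a, pi a = x by exists (repr x); rewrite /pi /= reprK.
move=> two_primes_case.
case: (four_elements_cases card_quot) => [[e Ke]|[invC ninv0 ninvU]].
  have Ke' := klein_sym Ke.
  have [p pI pe] := klein_class_prime R_UFD Ke (pi_surj e).
  have [q qI qe] := klein_class_prime R_UFD Ke' (pi_surj (1 + e)).
  split=> [_|[]].
    apply: (@elasticity_eqy _ _ _ 2) => // n; exists ((p * q) ^+ n.+2), n.+2.
    have [] := primes_power_factorizations pi_eq R_UFD Ke pI qI pe qe n.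
    by split=> //; rewrite -addn2 leq_addr.
  split; first exact: klein_iso Ke klein_poly.
  move=> c c0 ci; have [_ _ _ _ /(_ c)[] cE] := Ke; subst c.
  - by rewrite eqxx in c0.
  - by case: ci; exists 1; rewrite mulr1.
  - by exists p; first exact: irreducible_prime.
  - by exists q; first exact: irreducible_prime.
(* An isomorphism with Z[x]/(2, x^2 + x) would yield two noninvertible classes
   e and 1 - e, equal by locality, so that e = e (1 - e) = 0. *)
have len := local_length_unique pi_eq R_UFD invC ninv0 ninvU.
split=> [[[f [g fK gK]] _]|_]; last exact: elasticity_eq1 len.
have [_ tt t0 t1 _] := klein_poly; set t := (X in X != 0) in tt t0 t1.
have ee : g t * g t = g t by apply: (can_inj fK); rewrite rmorphM !gK tt.
have e0 : g t != 0 by apply: contra t0 => /eqP e; apply/eqP; rewrite -[LHS](gK t) e rmorph0.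
have e1 : g t != 1 by apply: contra t1 => /eqP e; apply/eqP; rewrite -[LHS](gK t) e rmorph1.
have ei : ~ inv (g t).
  by move=> gi; case/eqP: e1; apply: (inv_mulI gi); rewrite mulr1.
have ez : g t * (1 - g t) = 0 by rewrite mulrBr mulr1 ee subrr.
have d0 : 1 - g t != 0 by rewrite subr_eq0 eq_sym.
have di : ~ inv (1 - g t).
  move=> di; case/eqP: e0; apply: (inv_mulI di).
  by rewrite mulr0 mulrC.
case/eqP: (e0); rewrite -ee -[RHS]ez; congr (_ * _).
exact: ninvU.
Qed.
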